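(* Let $1<p<2$ and $1\leq r\leq p$. Let $(X_n)_{n\geq 1}$ be a sequence of identically distributed real-valued random variables on a probability space $(\Omega,\mathcal{F},P)$ with finite $p$th moment, i.e. $E|X_1|^p<\infty$. For $t\in[-\pi,\pi)$ let $S_n(t)=\sum_{k=1}^{n}e^{ikt}X_k$. Then for every $\epsilon>0$ and for almost all $t\in[-\pi,\pi)$, $$\sum_{n=1}^{\infty}n^{p/r-2}\,P\left[\max_{1\leq k\leq n}|S_k(t)|>\epsilon n^{1/r}\right]<\infty.$$
   Context: ''Almost all $t$'' is with respect to Lebesgue measure on $[-\pi,\pi)$. No independence or other dependence assumption is made on the sequence $(X_n)$. Here $i$ denotes the imaginary unit. *)

(* Defs.v *)
From HB Require Import structures.
From mathcomp Require Import all_boot all_order all_algebra.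
From mathcomp Require Import complex.
From mathcomp Require Import all_classical all_reals all_analysis.

Set Implicit Arguments.
Unset Strict Implicit.
Unset Printing Implicit Defensive.

Import Order.TTheory GRing.Theory Num.Theory.
Import numFieldNormedType.Exports.

Local Open Scope classical_set_scope.
Local Open Scope ring_scope.

(* Sequences are indexed from 1: [X 0] is unconstrained and never used.
   The laws are compared on measurable sets only, since a measure of the library
   is a function on all sets whose values off the sigma-algebra are arbitrary. *)
Definition identically_distributed d (T : measurableType d) (R : realType)
    (P : probability T R) (X : nat -> {RV P >-> R}) : Prop :=
  forall m n : nat, (1 <= m)%N -> (1 <= n)%N ->
  forall A : set R, measurable A ->
    distribution P (X m) A = distribution P (X n) A.

(* exp(i x), by Euler's formula *)
Definition expi (R : realType) (x : R) : R[i] := (cos x +i* sin x)%C.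

Definition fourier_sum (R : realType) (T : Type) (X : nat -> T -> R)
    (n : nat) (t : R) (w : T) : R[i] :=
  \sum_(1 <= k < n.+1) expi (k%:R * t) * (X k w)%:C%C.

(* [normc] is the complex modulus valued in R (the norm of R[i] is valued in
   R[i]); the moduli being nonnegative, 0 is a neutral default for the maximum. *)
Definition max_fourier_sum (R : realType) (T : Type) (X : nat -> T -> R)
    (n : nat) (t : R) (w : T) : R :=
  \big[Num.max/0]_(1 <= k < n.+1)
    ComplexField.Normc.normc (fourier_sum X k t w).

(* Main.v *)
Require Import Defs.
From HB Require Import structures.
From mathcomp Require Import all_boot all_order all_algebra.
From mathcomp Require Import complex.
From mathcomp Require Import all_classical all_reals all_analysis.
From mathcomp Require Import measurable_realfun.
From mathcomp Require Import zify ring lra.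

Set Implicit Arguments.
Unset Strict Implicit.
Unset Printing Implicit Defensive.

Import Order.TTheory GRing.Theory Num.Theory.
Import numFieldNormedType.Exports.

Local Open Scope classical_set_scope.
Local Open Scope ring_scope.

(** Why the statement holds.  Fix omega and write a_k for X_k(omega); the only
    thing to understand is the size of the set of t in [-pi, pi] on which some
    partial sum of the deterministic series of terms a_k e^(ikt), k <= n,
    exceeds eps n^(1/r).  Integrating over omega, and exchanging the two
    integrations by Tonelli's theorem, then controls the integral over t of
    each term of the series, and a series of nonnegative functions whose
    integrals have a finite sum is finite almost everywhere.  The bound on the
    size of the set will be a sum of functions of the individual a_k, so that
    its expectation depends on the common law of the X_k only.

    The L^2 maximal inequality for trigonometric sums is Carleson's theorem,
    but the strict inequality p < 2 leaves room for an elementary substitute.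
    For an exponent q < 2 the maximal function is bounded from l^q to L^2
    (Menshov, Paley, Christ and Kiselev): the integral of
    max_k |S_k(t)|^2 is at most a constant times (sum_k |a_k|^q)^(2/q).  To see
    it, cut the sum at the index where half of the mass sum_k |a_k|^q is
    reached.  The maximum is at most the modulus of the left half (whose L^2
    norm is explicit, by orthogonality) plus the term at the cut plus the larger
    of the two maximal functions of the halves.  Since 2/q > 1, two halves of the mass contribute
    strictly less than the whole, so the recursion contracts:
    [maximal_inequality].

    Chebyshev's inequality then gives, with lambda = n^(1/r), that the set has
    measure at most a constant times sum_(k <= n) min(1, (|a_k| / lambda)^q):
    [level_set_le].  Choose q strictly between p and 2.  Taking expectations and
    using that the X_k have the same law, the series over n of the integrals is
    at most a constant times the expectation of
    sum_n n^(p/r - 1) min(1, (|X_1| / n^(1/r))^q).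
    The terms with n <= |X_1|^r add up to at most |X_1|^p because p/r >= 1, and
    the others form the tail of a convergent series because q > p, which is
    again at most a constant times |X_1|^p: [moment_series_le]. *)

(** * Partial trigonometric sums over blocks of indices *)

(** Blocks of indices, rather than initial segments, so that the two sides of a
    cut are again of the same form. *)
Definition block_sum (R : realType) (a : nat -> R) (m n : nat) (t : R) : R[i] :=
  \sum_(m <= k < n) expi (k%:R * t) * (a k)%:C%C.

Definition block_max (R : realType) (a : nat -> R) (m n : nat) (t : R) : R :=
  \big[Num.max/0]_(m <= k < n)
    ComplexField.Normc.normc (block_sum a m k.+1 t).

Section pointwise.
Variables (R : realType) (a : nat -> R).
Implicit Types (m n j k : nat) (t : R).
Local Notation normc := ComplexField.Normc.normc.
Local Notation S := (block_sum a).
Local Notation M := (block_max a).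

Lemma normc_ge0 (z : R[i]) : 0 <= normc z.
Proof. by case: z => x y /=; exact: sqrtr_ge0. Qed.

Lemma le_normc_add (y z : R[i]) : normc (y + z) <= normc y + normc z.
Proof. exact: (le_normcD y z). Qed.

Lemma normc_expiM (x b : R) : normc (expi x * b%:C%C) = `|b|.
Proof.
rewrite ComplexField.Normc.normcM /= cos2Dsin2 sqrtr1 mul1r.
by rewrite expr0n addr0 sqrtr_sqr.
Qed.

Lemma block_sum_cat m j n t : (m <= j)%N -> (j <= n)%N ->
  S m n t = S m j t + S j n t.
Proof. by move=> mj jn; rewrite /block_sum (big_cat_nat mj jn). Qed.

Lemma block_max_ge0 m n t : 0 <= M m n t.
Proof.
rewrite /block_max big_seq; apply: (big_ind (fun x => 0 <= x)) => //.
- by move=> x y x0 y0; rewrite le_max x0.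
- by move=> k _; exact: normc_ge0.
Qed.

Lemma le_block_max m n k t : (m <= k < n)%N -> normc (S m k.+1 t) <= M m n t.
Proof.
move=> mkn; rewrite /block_max.
by apply: (le_bigmax_seq _ k xpredT (fun k => normc (S m k.+1 t)));
  rewrite ?mem_index_iota.
Qed.

(** Cutting at j: a partial sum that stops before j is seen by the maximal
    function of the left part; one that goes past j consists of the whole left
    part, the term j and a partial sum of the right part. *)
Lemma block_max_split m j n t : (m <= j < n)%N ->
  M m n t <= normc (S m j t) + `|a j| + Num.max (M m j t) (M j.+1 n t).
Proof.
move=> /andP[mj jn]; rewrite {1}/block_max big_seq.
have N0 := normc_ge0 (S m j t); have a0 := normr_ge0 (a j).
have M10 := block_max_ge0 m j t; have M20 := block_max_ge0 j.+1 n t.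
apply: bigmax_le => [|k]; first by rewrite !addr_ge0// le_max M10.
rewrite mem_index_iota => /andP[mk kn].
have [kj|jk|->] := ltngtP k j.
- rewrite -[leLHS]add0r lerD ?addr_ge0// le_max le_block_max//.
  by rewrite mk kj.
- rewrite (block_sum_cat _ mj (leqW (ltnW jk))).
  rewrite (block_sum_cat _ (leqnSn j) (leqW jk)) addrA.
  apply: le_trans (le_normc_add _ _) _; apply: lerD.
    apply: le_trans (le_normc_add _ _) _; rewrite lerD2l.
    by rewrite /block_sum big_nat1 normc_expiM.
  by rewrite le_max (@le_block_max j.+1 n) ?orbT// jk.
- rewrite (block_sum_cat _ mj (leqnSn j)).
  rewrite -[leLHS]addr0 lerD ?le_max ?M10//.
  apply: le_trans (le_normc_add _ _) _; rewrite lerD2l.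
  by rewrite /block_sum big_nat1 normc_expiM.
Qed.

(** The parameter c is kept free because the recursion on blocks can only
    tolerate a factor 1 + c close to 1 in front of y. *)
Lemma sqrrD_le (x y c : R) : 0 < c ->
  (x + y) ^+ 2 <= (1 + c^-1) * x ^+ 2 + (1 + c) * y ^+ 2.
Proof.
move=> c0; rewrite -subr_ge0.
rewrite (_ : _ - _ = c^-1 * (x - c * y) ^+ 2); last by field; rewrite gt_eqF.
by rewrite mulr_ge0 ?sqr_ge0// invr_ge0 ltW.
Qed.

(** The square of the larger of the two maximal functions is bounded by the sum
    of the squares: each of the two will be bounded by a power of the mass of its
    block, and such powers are superadditive. *)
Lemma sqr_block_max_split m j n t (c : R) : 0 < c -> (m <= j < n)%N ->
  M m n t ^+ 2 <= (1 + c^-1) * (2 * (normc (S m j t) ^+ 2 + a j ^+ 2)) +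
                  (1 + c) * (M m j t ^+ 2 + M j.+1 n t ^+ 2).
Proof.
move=> c0 mjn; have N0 := normc_ge0 (S m j t).
have M0 := block_max_ge0 m n t; have a0 := normr_ge0 (a j).
have M10 := block_max_ge0 m j t; have M20 := block_max_ge0 j.+1 n t.
have Mx0 : 0 <= Num.max (M m j t) (M j.+1 n t) by rewrite le_max M10.
apply: le_trans (_ : _ <= (normc (S m j t) + `|a j| +
    Num.max (M m j t) (M j.+1 n t)) ^+ 2) _.
  by rewrite ler_pXn2r// ?nnegrE ?addr_ge0//; exact: block_max_split.
apply: le_trans (sqrrD_le _ _ c0) _; apply: lerD.
  rewrite ler_pM2l; last by rewrite addr_gt0// invr_gt0.
  apply: le_trans (sqrrD_le _ _ ltr01) _.
  by rewrite invr1 real_normK ?num_real// mulrDr.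
rewrite ler_pM2l; last by rewrite addr_gt0.
have M12 := sqr_ge0 (M m j t); have M22 := sqr_ge0 (M j.+1 n t).
by rewrite /Num.max; case: ifP => _; rewrite ?lerDl ?lerDr.
Qed.

Lemma block_sumE m n t : S m n t =
  ((\sum_(m <= k < n) a k * cos (k%:R * t)) +i*
   (\sum_(m <= k < n) a k * sin (k%:R * t)))%C.
Proof.
rewrite /block_sum; elim/big_rec3: _ => // k z y x _ ->.
rewrite /expi; apply/eqP; rewrite eq_complex /=.
by apply/andP; split; apply/eqP; ring.
Qed.

Lemma sqr_normc_block_sum m n t : normc (S m n t) ^+ 2 =
  (\sum_(m <= k < n) a k * cos (k%:R * t)) ^+ 2 +
  (\sum_(m <= k < n) a k * sin (k%:R * t)) ^+ 2.
Proof. by rewrite block_sumE /= sqr_sqrtr// addr_ge0 ?sqr_ge0. Qed.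

(** Adding one term: the cross terms are cosines of nonzero frequencies, hence
    have integral zero over a period. *)
Lemma sqr_normc_block_sumS m n t : (m <= n)%N ->
  normc (S m n.+1 t) ^+ 2 = normc (S m n t) ^+ 2 + a n ^+ 2 +
  \sum_(m <= k < n) 2 * a n * a k * cos ((n - k)%:R * t).
Proof.
move=> mn; rewrite !sqr_normc_block_sum !big_nat_recr//=.
set c := \sum_(_ <= _ < _) _; set s := \sum_(_ <= _ < _) _.
have -> : \sum_(m <= k < n) 2 * a n * a k * cos ((n - k)%:R * t) =
    2 * a n * (c * cos (n%:R * t) + s * sin (n%:R * t)).
  rewrite mulrDr !mulr_suml !mulr_sumr -big_split/=.
  apply: eq_big_nat => k /andP[_ kn].
  have -> : cos ((n - k)%:R * t) = cos (n%:R * t) * cos (k%:R * t) +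
      sin (n%:R * t) * sin (k%:R * t).
    by rewrite natrB ?(ltnW kn)// mulrBl cosB.
  by ring.
have := cos2Dsin2 (n%:R * t).
set C := cos _; set Z := sin _ => CZ.
clearbody c s C Z.
have -> : a n ^+ 2 = a n ^+ 2 * (C ^+ 2 + Z ^+ 2) by rewrite CZ mulr1.
by ring.
Qed.

End pointwise.

(** * Orthogonality of the exponentials *)

Section torus_integral.
Variable R : realType.
Local Notation mu := (@lebesgue_measure R).
Local Notation D := (`[- pi, pi]%classic : set R).
Local Notation normc := ComplexField.Normc.normc.

(** The value of the integral bundled with continuity, which provides the
    integrability needed to add such statements. *)
Definition torus_integral (f : R -> R) (c : R) : Prop :=
  continuous f /\ (\int[mu]_(t in D) (f t)%:E = c%:E)%E.

Lemma torus_integralD f g b c : torus_integral f b -> torus_integral g c ->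
  torus_integral (fun t => f t + g t) (b + c).
Proof.
move=> [cf fE] [cg gE]; split; first by move=> t; apply: cvgD; [exact: cf|exact: cg].
have int h : continuous h -> mu.-integrable D (EFin \o h).
  move=> ch; apply: continuous_compact_integrable; first exact: segment_compact.
  exact: continuous_subspaceT.
under eq_integral do rewrite EFinD.
rewrite (@integralD _ _ R mu D _ (EFin \o f) (EFin \o g)) ?fE ?gE//; exact: int.
Qed.

Lemma torus_integral_cst (b : R) : torus_integral (fun=> b) (2 * pi * b).
Proof.
split; first by move=> t; exact: cvg_cst.
rewrite integral_cst//= lebesgue_measure_itv/= lte_fin.
have pi0 := pi_gt0 R.
rewrite ifT; last by lra.
by rewrite -EFinD -EFinM; congr EFin; ring.
Qed.

Lemma torus_integral_cos (b : R) (j : nat) : (0 < j)%N ->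
  torus_integral (fun t => b * cos (j%:R * t)) 0.
Proof.
move=> j0; have j0' : (j%:R : R) != 0 by rewrite pnatr_eq0 -lt0n.
have pi0 := pi_gt0 R.
have dj (t : R) : is_derive t 1 ( *%R (j%:R : R)) j%:R.
  rewrite -[X in is_derive _ _ _ X]mulr1.
  exact: (@is_deriveZ R R R^o (fun u : R => u) j%:R t 1 1 (is_derive_id _ _)).
have dcos (t : R) : is_derive t 1 (fun u : R => b * cos (j%:R * u))
    (b * (- sin (j%:R * t) * j%:R)).
  exact: (@is_deriveZ R R R^o (cos \o *%R j%:R) b t 1 _
    (is_derive1_comp (is_derive_cos _) (dj t))).
pose F (t : R) := b / j%:R * sin (j%:R * t).
have dF (t : R) : is_derive t 1 F (b * cos (j%:R * t)).
  rewrite (_ : b * _ = b / j%:R * (cos (j%:R * t) * j%:R)); last by field.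
  exact: (@is_deriveZ R R R^o (sin \o *%R j%:R) (b / j%:R) t 1 _
    (is_derive1_comp (is_derive_sin _) (dj t))).
have cont (f df : R -> R) : (forall t : R, is_derive t 1 f (df t)) -> continuous f.
  move=> fd t; apply: differentiable_continuous; apply/derivable1_diffP.
  by have [] := fd t.
split; first exact: cont dcos.
rewrite (@continuous_FTC2 _ _ F).
- rewrite /F mulrN sinN.
  have -> : sin (j%:R * pi) = 0 :> R.
    by rewrite mulr_natl -[_ *+ _]add0r (alternatingn (@sinDpi R)) sin0 mulr0.
  by rewrite oppr0 mulr0 sube0.
- lra.
- by apply: continuous_subspaceT; exact: cont dcos.
- have cF := cont _ _ dF; split => [t _||]; first by have [] := dF t.
  + by apply: cvg_at_right_filter; exact: cF.
  + by apply: cvg_at_left_filter; exact: cF.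
- by move=> t _; rewrite derive1E; apply: derive_val.
Qed.

Lemma torus_integral_sum (a : nat -> R) (m n l : nat) : (n <= l)%N ->
  torus_integral (fun t => \sum_(m <= k < n) a k * cos ((l - k)%:R * t)) 0.
Proof.
have E0 (f : R -> R) : f = (fun=> 0) -> torus_integral f 0.
  by move=> ->; have := torus_integral_cst 0; rewrite mulr0.
elim: n => [_|n IH nl].
  by apply: E0; apply/funext => t; rewrite big_geq.
have [mn|nm] := leqP m n; last first.
  by apply: E0; apply/funext => t; rewrite big_geq.
under [X in torus_integral X]eq_fun do rewrite big_nat_recr//=.
rewrite -[X in torus_integral _ X]addr0; apply: torus_integralD; first exact: IH (ltnW nl).
by apply: torus_integral_cos; rewrite subn_gt0.
Qed.

Lemma torus_integral_sqr_block_sum (a : nat -> R) (m n : nat) :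
  torus_integral (fun t => normc (block_sum a m n t) ^+ 2)
    (2 * pi * \sum_(m <= k < n) a k ^+ 2).
Proof.
have E0 n' : (n' <= m)%N -> torus_integral (fun t => normc (block_sum a m n' t) ^+ 2)
    (2 * pi * \sum_(m <= k < n') a k ^+ 2).
  move=> nm; rewrite [in X in torus_integral _ X]big_geq//.
  under [X in torus_integral X]eq_fun do
    rewrite /block_sum big_geq// ComplexField.Normc.normc0 expr0n/=.
  exact: torus_integral_cst.
elim: n => [|n IH]; first exact: E0.
have [mn|nm] := leqP m n; last exact: E0.
under [X in torus_integral X]eq_fun do rewrite sqr_normc_block_sumS//.
rewrite big_nat_recr//= mulrDr -[X in torus_integral _ X]addr0.
apply: torus_integralD; last exact: torus_integral_sum.
by apply: torus_integralD => //; exact: torus_integral_cst.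
Qed.
End torus_integral.

(** * Measurability of the maximal function *)

(** Both the frequency variable and the coefficients may depend on u: this
    covers the maximal function of fixed coefficients as a function of t, and
    the one of the random coefficients as a function of (t, omega). *)
Lemma measurable_block_max (R : realType) d (U : measurableType d)
    (th : U -> R) (x : nat -> U -> R) (m n : nat) :
  measurable_fun setT th -> (forall k, measurable_fun setT (x k)) ->
  measurable_fun setT (fun u => block_max (x^~ u) m n (th u)).
Proof.
move=> mth mx; rewrite /block_max.
elim: (index_iota m n) => [|k s IH].
  by under eq_fun do rewrite big_nil; exact: measurable_cst.
under eq_fun do rewrite big_cons.
apply: measurable_maxr => //.
have mtrig (f : R -> R) : continuous f ->
    measurable_fun setT (fun u => \sum_(m <= i < k.+1) x i u * f (i%:R * th u)).
  move=> cf; apply: measurable_sum => i; apply: measurable_funM => //.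
  apply: (measurableT_comp (continuous_measurable_fun cf)).
  exact: measurable_funM.
under eq_fun do rewrite block_sumE/=.
apply: (measurableT_comp (continuous_measurable_fun (@sqrt_continuous R))).
apply: measurable_funD; apply: measurable_funX; apply: mtrig.
  exact: continuous_cos.
exact: continuous_sin.
Qed.

(** * Superadditivity of powers and cutting at the median *)

Section power_sums.
Variable R : realType.
Implicit Types (x y V g : R) (v : nat -> R).

Lemma sum_cut v (m j n : nat) : (m <= j < n)%N ->
  \sum_(m <= k < n) v k =
  \sum_(m <= k < j) v k + v j + \sum_(j.+1 <= k < n) v k.
Proof.
move=> /andP[mj jn]; rewrite (big_cat_nat mj (ltnW jn))/= -addrA.
by congr (_ + _); rewrite big_ltn.
Qed.

(** The median of the weights v: the first index at which half of the total
    weight is reached. *)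
Lemma median_index v (m n : nat) : (forall k, 0 <= v k) -> (m < n)%N ->
  exists j, [/\ (m <= j < n)%N,
    2 * \sum_(m <= k < j) v k <= \sum_(m <= k < n) v k &
    2 * \sum_(j.+1 <= k < n) v k <= \sum_(m <= k < n) v k].
Proof.
move=> v0 mn; set V := \sum_(m <= k < n) v k.
have V0 : 0 <= V by apply: sumr_ge0.
pose Q j := (m <= j < n)%N && (V <= 2 * \sum_(m <= k < j.+1) v k).
have exQ : exists j, Q j.
  exists n.-1; rewrite /Q (ltn_predK mn); apply/andP; split; [lia|].
  by rewrite -/V mulr_natl mulr2n lerDl.
case: (ex_minnP exQ) => j /andP[mjn Vj] minj; exists j; split => //.
  have [->|jm] := eqVneq j m; first by rewrite big_geq ?mulr0.
  rewrite leNgt; apply/negP => lt_V.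
  suff /minj : Q j.-1 by lia.
  by rewrite /Q prednK ?(ltW lt_V) ?andbT; lia.
have : V = \sum_(m <= k < j.+1) v k + \sum_(j.+1 <= k < n) v k.
  by rewrite -big_cat_nat//; lia.
move: Vj; move: (\sum_(m <= k < j.+1) _) (\sum_(j.+1 <= k < _) _) => p q.
lra.
Qed.

(** One factor x + y is distributed, and the other one only decreases when it is
    replaced by x or y. *)
Lemma powRD_ge x y g : 0 <= x -> 0 <= y -> 1 <= g ->
  x `^ g + y `^ g <= (x + y) `^ g.
Proof.
move=> x0 y0 g1; have g0 : 0 < g by lra.
rewrite -3?[_ `^ g]mulr_powRB1 ?addr_ge0// mulrDl.
have le z : 0 <= z -> z <= x + y ->
    z * z `^ (g - 1) <= z * (x + y) `^ (g - 1).
  move=> z0 zxy; apply: ler_wpM2l => //.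
  by apply: ge0_ler_powR; rewrite ?nnegrE ?subr_ge0 ?addr_ge0.
by apply: lerD; apply: le; rewrite ?lerDl ?lerDr.
Qed.

Lemma sum_powR_le v g (m n : nat) : (forall k, 0 <= v k) -> 1 <= g ->
  \sum_(m <= k < n) v k `^ g <= (\sum_(m <= k < n) v k) `^ g.
Proof.
move=> v0 g1.
elim: (index_iota m n) => [|k s IH].
  by rewrite !big_nil powR_ge0.
rewrite !big_cons; apply: le_trans (powRD_ge _ _ g1) => //.
  by rewrite lerD2l.
exact: sumr_ge0.
Qed.

(** Where the contraction comes from: when neither x nor y exceeds half of V,
    the superadditivity of the power g > 1 is strict by a fixed factor. *)
Lemma powR_halves_le x y V g : 0 <= x -> 0 <= y -> 2 * x <= V -> 2 * y <= V ->
  x + y <= V -> 1 <= g -> x `^ g + y `^ g <= (2^-1) `^ (g - 1) * V `^ g.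
Proof.
move=> x0 y0 xV yV xyV g1; have g0 : 0 < g by lra.
have V0 : 0 <= V by lra.
have half z : 0 <= z -> 2 * z <= V ->
    z `^ g <= z * ((2^-1) `^ (g - 1) * V `^ (g - 1)).
  move=> z0 zV; rewrite -powRM// -[z `^ g]mulr_powRB1//.
  apply: ler_wpM2l => //; apply: ge0_ler_powR; rewrite ?nnegrE//; lra.
apply: le_trans (lerD (half _ x0 xV) (half _ y0 yV)) _.
rewrite -mulrDl -[V `^ g]mulr_powRB1// [leRHS]mulrCA.
by apply: ler_wpM2r => //; rewrite mulr_ge0// powR_ge0.
Qed.

End power_sums.

(** * The maximal inequality *)

Section maximal_inequality.
Variable R : realType.
Local Notation mu := (@lebesgue_measure R).
Local Notation D := (`[- pi, pi]%classic : set R).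
Local Notation normc := ComplexField.Normc.normc.

(** The relative loss when a mass is cut in two halves and g-th powers are
    summed. *)
Definition gap (g : R) : R := 1 - 2^-1 `^ (g - 1).

Lemma gap_gt0 (g : R) : 1 < g -> 0 < gap g.
Proof.
move=> g1; rewrite subr_gt0.
have : 2^-1 `^ (g - 1) < 1 `^ (g - 1).
  by apply: gt0_ltr_powR; rewrite ?nnegrE ?invr_ge0 ?subr_gt0//; lra.
by rewrite powR1.
Qed.

(** With c the gap, the recursion turns an admissible constant A into
    4 pi (1 + 1/c) + (1 + c) (1 - c) A, of which this is the fixed point. *)
Definition maximal_cst (g : R) : R :=
  4 * pi * (1 + (gap g)^-1) / gap g ^+ 2.

Lemma maximal_cst_ge0 (g : R) : 1 < g -> 0 <= maximal_cst g.
Proof.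
move=> g1; have c0 := gap_gt0 g1; have pi0 := pi_gt0 R.
rewrite /maximal_cst mulr_ge0// ?invr_ge0 ?sqr_ge0//.
by rewrite !mulr_ge0 ?ltW// addr_gt0 ?invr_gt0.
Qed.

Lemma measurable_sqr_block_max (a : nat -> R) (m n : nat) (E : set R) :
  measurable E -> measurable_fun E (fun t => (block_max a m n t ^+ 2)%:E).
Proof.
move=> mE; apply/measurable_EFinP; apply: measurable_funTS.
apply: measurable_funX.
by apply: (@measurable_block_max R _ _ id (fun k _ => a k)).
Qed.

(** With g = 2/q and v_k = |a_k|^q this is the boundedness of the maximal function
    from l^q to L^2, by induction on the length of the block, which is cut at
    the median of v.  The left part and the term at the cut contribute through
    their L^2 norms, which orthogonality and superadditivity bound by the g-th
    power of the total mass; the two remaining blocks contribute by induction,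
    and the gap absorbs both contributions. *)
Lemma maximal_inequality (a v : nat -> R) (g : R) (m n : nat) :
  1 < g -> (forall k, 0 <= v k) -> (forall k, a k ^+ 2 = v k `^ g) ->
  (\int[mu]_(t in D) (block_max a m n t ^+ 2)%:E <=
   (maximal_cst g * (\sum_(m <= k < n) v k) `^ g)%:E)%E.
Proof.
move=> g1 v0 av; have c0 := gap_gt0 g1; set c := gap g in c0.
have g1' := ltW g1; have pi0 := pi_gt0 R.
have mD : measurable D by exact: measurable_itv.
have [l] := ubnP (n - m); elim: l => // l IH in m n *; rewrite ltnS => nml.
have [nm|mn] := leqP n m.
  rewrite (eq_integral (cst 0%E)); last first.
    by move=> t _; rewrite /block_max big_geq// expr0n.
  by rewrite integral0 lee_fin mulr_ge0 ?powR_ge0 ?maximal_cst_ge0.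
have [j [mjn Vl Vr]] := median_index v0 mn.
have IH1 : (\int[mu]_(t in D) (block_max a m j t ^+ 2)%:E <= _)%E := IH m j ltac:(lia).
have IH2 : (\int[mu]_(t in D) (block_max a j.+1 n t ^+ 2)%:E <= _)%E := IH j.+1 n ltac:(lia).
set V := \sum_(m <= k < n) v k in Vl Vr *.
set V1 := \sum_(m <= k < j) v k in Vl IH1.
set V2 := \sum_(j.+1 <= k < n) v k in Vr IH2.
have [cS iS] := torus_integral_sqr_block_sum a m j.
have mS : measurable_fun D (fun t => (normc (block_sum a m j t) ^+ 2)%:E).
  by apply/measurable_EFinP; apply: measurable_funTS; exact: continuous_measurable_fun.
apply: (@le_trans _ _ (\int[mu]_(t in D)
   (((1 + c^-1) * 2)%:E * ((normc (block_sum a m j t) ^+ 2)%:E + (a j ^+ 2)%:E) +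
    (1 + c)%:E * ((block_max a m j t ^+ 2)%:E + (block_max a j.+1 n t ^+ 2)%:E)))%E).
  apply: ge0_le_integral => //.
  - by move=> t _; rewrite lee_fin sqr_ge0.
  - exact: measurable_sqr_block_max.
  - apply: emeasurable_funD; apply: measurable_funeM.
      by apply: emeasurable_funD => //; exact: measurable_cst.
    by apply: emeasurable_funD; exact: measurable_sqr_block_max.
  - move=> t _; rewrite -!EFinD lee_fin -mulrA.
    exact: sqr_block_max_split.
have mM i k : measurable_fun D (fun t => (block_max a i k t ^+ 2)%:E).
  exact: measurable_sqr_block_max.
have M0 i k t : (0 <= (block_max a i k t ^+ 2)%:E)%E.
  by rewrite lee_fin sqr_ge0.
have S0 t : (0 <= (normc (block_sum a m j t) ^+ 2)%:E)%E.
  by rewrite lee_fin sqr_ge0.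
have a0 : (0 <= (a j ^+ 2)%:E)%E by rewrite lee_fin sqr_ge0.
have k10 : (0 <= ((1 + c^-1) * 2)%:E)%E.
  by rewrite lee_fin mulr_ge0// addr_ge0// invr_ge0 ltW.
have k20 : (0 <= (1 + c)%:E)%E by rewrite lee_fin addr_ge0// ltW.
rewrite ge0_integralD//; first last.
- by apply: measurable_funeM; apply: emeasurable_funD; exact: mM.
- by move=> t _; apply: mule_ge0 => //; apply: adde_ge0; rewrite lee_fin sqr_ge0.
- by apply: measurable_funeM; apply: emeasurable_funD => //; exact: measurable_cst.
- by move=> t _; apply: mule_ge0 => //; apply: adde_ge0; rewrite lee_fin sqr_ge0.
rewrite ge0_integralZl//; first last.
- by move=> t _; apply: adde_ge0; rewrite lee_fin sqr_ge0.
- by apply: emeasurable_funD => //; exact: measurable_cst.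
rewrite [X in (_ + X)%E]ge0_integralZl//; first last.
- by move=> t _; apply: adde_ge0; rewrite lee_fin sqr_ge0.
- by apply: emeasurable_funD; exact: mM.
rewrite ge0_integralD//.
rewrite [X in (_ + _ * X)%E]ge0_integralD//; [|exact: mM|exact: mM].
rewrite iS (torus_integral_cst (a j ^+ 2)).2.
apply: le_trans (leeD (lexx _) (lee_wpmul2l k20 (leeD IH1 IH2))) _.
rewrite -!EFinD lee_fin.
have V10 : 0 <= V1 by exact: sumr_ge0.
have V20 : 0 <= V2 by exact: sumr_ge0.
have V12 : V1 + V2 <= V.
  by rewrite /V (sum_cut _ mjn) lerD2r lerDl.
have := powR_halves_le V10 V20 Vl Vr V12 g1'.
have -> : 2^-1 `^ (g - 1) = 1 - c by rewrite /c /gap subKr.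
have : \sum_(m <= k < j) a k ^+ 2 + a j ^+ 2 <= V `^ g.
  apply: le_trans (sum_powR_le m n v0 g1').
  rewrite (sum_cut (fun k => v k `^ g) mjn) av.
  rewrite ler_wpDr//; first by apply: sumr_ge0 => k _; exact: powR_ge0.
  by rewrite lerD2r; apply: ler_sum => k _; rewrite av.
have := maximal_cst_ge0 g1.
have : maximal_cst g * c ^+ 2 = 4 * pi * (1 + c^-1).
  by rewrite /maximal_cst -/c divfK// expf_neq0// gt_eqF.
move: (maximal_cst g) (V `^ g) (V1 `^ g) (V2 `^ g) (\sum_(_ <= _ < _) _) (a j ^+ 2).
move=> A W W1 W2 s b Ac A0 sW W12.
have h1 : 0 <= 1 + c^-1 by rewrite addr_ge0// invr_ge0 ltW.
(* h2 and h3 are the two inequalities above with the weights that they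
   receive in the recursion; the constant is chosen so that they add up. *)
have h2 : 0 <= 4 * pi * (1 + c^-1) * (W - (s + b)).
  by rewrite mulr_ge0// ?subr_ge0// !mulr_ge0// ltW.
have h3 : 0 <= A * (1 + c) * ((1 - c) * W - (W1 + W2)).
  by rewrite mulr_ge0// ?subr_ge0// mulr_ge0// addr_ge0// ltW.
rewrite -subr_ge0; apply: le_trans (addr_ge0 h2 h3) _.
rewrite -Ac le_eqVlt; apply/orP; left; apply/eqP.
have -> : (1 + c^-1) * 2 * (2 * pi * s + 2 * pi * b) = A * c ^+ 2 * (s + b).
  by rewrite Ac; ring.
ring.
Qed.

End maximal_inequality.

(** * The measure of the level sets *)

Section level_sets.
Variable R : realType.
Local Notation mu := (@lebesgue_measure R).
Local Notation D := (`[- pi, pi]%classic : set R).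

Definition level_cst (q eps : R) : R :=
  2 * pi + maximal_cst (2 / q) / eps ^+ 2.

(** The minimum with 1 stands for a truncation of the coefficients at lam.  If
    the sum is at least 1, the whole period is small enough; otherwise no
    coefficient reaches lam, the minima are the powers themselves, and
    Chebyshev's inequality applied to the maximal inequality gives the sum to
    the power 2/q > 1, which for a number below 1 is even better than needed. *)
Lemma level_set_le (a : nat -> R) (q eps lam : R) (m n : nat) :
  0 < q < 2 -> 0 < eps -> 0 < lam ->
  (mu (D `&` [set t | (eps * lam < block_max a m n t)%R]) <=
   (level_cst q eps *
    \sum_(m <= k < n) Num.min 1 ((`|a k| / lam) `^ q))%:E)%E.
Proof.
move=> /andP[q0 q2] e0 l0; have pi0 := pi_gt0 R.
set W := \sum_(m <= k < n) _.
have g1 : 1 < 2 / q by rewrite ltr_pdivlMr// mul1r.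
have A0 := maximal_cst_ge0 g1.
have min0 k : 0 <= Num.min 1 ((`|a k| / lam) `^ q).
  by rewrite le_min ler01 powR_ge0.
have W0 : 0 <= W by exact: sumr_ge0.
have Ae0 : 0 <= maximal_cst (2 / q) / eps ^+ 2.
  by rewrite divr_ge0// sqr_ge0.
have mD : measurable D by exact: measurable_itv.
have mM : measurable_fun setT (block_max a m n).
  exact: (@measurable_block_max R _ _ id (fun k _ => a k)).
have mlt : measurable (D `&` [set t | eps * lam < block_max a m n t]).
  apply: measurableI => //.
  rewrite (_ : [set _ | _] = setT `&` block_max a m n @^-1` `]eps * lam, +oo[).
    exact: mM.
  by rewrite setTI; apply/seteqP; split=> t /=; rewrite in_itv/= andbT.
have mle : measurable (D `&` [set t | eps * lam <= block_max a m n t]).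
  apply: measurableI => //.
  rewrite (_ : [set _ | _] = setT `&` block_max a m n @^-1` `[eps * lam, +oo[).
    exact: mM.
  by rewrite setTI; apply/seteqP; split=> t /=; rewrite in_itv/= andbT.
have [W1|W1] := leP 1 W.
  apply: (@le_trans _ _ (mu D)).
    by apply: le_measure; rewrite ?inE//; exact: subIsetl.
  rewrite lebesgue_measure_itv/= lte_fin ifT; last by lra.
  rewrite -EFinD lee_fin opprK; apply: le_trans (_ : 2 * pi * W <= _).
    by rewrite -[leLHS]mulr1 mulrDl; nra.
  by rewrite ler_wpM2r// lerDl.
(* From here on the sum is below 1, so that no term is truncated. *)
pose w k := (`|a k| / lam) `^ q.
have WE : W = \sum_(m <= k < n) w k.
  apply: eq_big_nat => k kmn; rewrite min_r// leNgt; apply/negP => lt1w.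
  have : Num.min 1 (w k) <= W.
    by rewrite /W (sum_cut _ kmn) ler_wpDr ?sumr_ge0// ler_wpDl ?sumr_ge0.
  by rewrite min_l ?(ltW lt1w)// leNgt W1.
have wg k : w k `^ (2 / q) = (`|a k| / lam) ^+ 2.
  rewrite -powRrM mulrCA mulfV ?gt_eqF// mulr1.
  by rewrite -powR_mulrn ?divr_ge0// ltW.
have lg : (lam `^ q) `^ (2 / q) = lam ^+ 2.
  by rewrite -powRrM mulrCA mulfV ?gt_eqF// mulr1 -powR_mulrn ?ltW.
have v0 k : 0 <= lam `^ q * w k by rewrite mulr_ge0// powR_ge0.
have av k : a k ^+ 2 = (lam `^ q * w k) `^ (2 / q).
  rewrite powRM ?powR_ge0// wg lg expr_div_n mulrCA mulfV ?mulr1.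
    by rewrite real_normK ?num_real.
  by rewrite expf_neq0// gt_eqF.
have := maximal_inequality m n g1 v0 av.
rewrite -mulr_sumr -WE powRM ?powR_ge0// lg => ck.
have el0 : 0 < (eps * lam) ^+ 2 by rewrite exprn_gt0// mulr_gt0.
have := @le_integral_abse _ _ _ mu D mD _ _ (measurable_sqr_block_max a m n mD) el0.
under eq_integral do rewrite gee0_abs ?lee_fin ?sqr_ge0//.
rewrite [X in (_ * mu X)%E](_ : _ = D `&` [set t | eps * lam <= block_max a m n t]);
  last first.
  congr (_ `&` _); apply/seteqP; split => t /=;
    by rewrite lee_fin ger0_norm ?sqr_ge0// ler_pXn2r// ?nnegrE
      ?block_max_ge0// mulr_ge0// ltW.
move=> /le_trans /(_ ck); rewrite -lee_pdivlMl// => markov.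
apply: le_trans (le_trans _ markov) _.
  by apply: le_measure; rewrite ?inE// => t [Dt /= lt]; split => //=; exact: ltW.
rewrite -EFinM lee_fin /level_cst.
have WW : W `^ (2 / q) <= W.
  have [->|Wn0] := eqVneq W 0; first by rewrite powR0// gt_eqF// divr_gt0.
  by apply: ge1r_powR; [rewrite lt_def Wn0 W0 ltW|exact: ltW].
rewrite [leLHS](_ : _ = maximal_cst (2 / q) / eps ^+ 2 * W `^ (2 / q)).
  apply: ler_pM => //; first exact: powR_ge0.
  by rewrite lerDr mulr_ge0// ltW.
by field; rewrite !gt_eqF.
Qed.

End level_sets.

(** * Summing the truncated moments *)

Section moment_series.
Variable R : realType.
Implicit Types (r s u x y : R).

Lemma powRD_gt0 x r s : 0 < x -> x `^ r * x `^ s = x `^ (r + s).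
Proof. by move=> x0; rewrite powRD//; apply/implyP => _; rewrite gt_eqF. Qed.

Lemma powRN_le s x y : 0 < s -> 0 < x -> x <= y -> (y `^ s)^-1 <= (x `^ s)^-1.
Proof.
move=> s0 x0 xy; have y0 := lt_le_trans x0 xy.
rewrite lef_pV2 ?posrE ?powR_gt0//.
by apply: ge0_ler_powR => //; rewrite ?nnegrE ltW.
Qed.

(** From (1 + x)^s = exp (s ln (1 + x)) >= 1 + s ln (1 + x) and
    ln (1 + x) >= x / (1 + x) >= x / 2. *)
Lemma powR1D_ge s x : 0 < s -> 0 <= x <= 1 -> 1 + s * x / 2 <= (1 + x) `^ s.
Proof.
move=> s0 /andP[x0 x1]; have x10 : 0 < 1 + x by lra.
rewrite /powR gt_eqF//; apply: le_trans (expR_ge1Dx _).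
rewrite lerD2l -mulrA (ler_wpM2l (ltW s0))//.
have le_ln : - ln (1 + x) <= - (x / (1 + x)).
  rewrite -lnV ?posrE//.
  rewrite [X in ln X](_ : _ = 1 + - (x / (1 + x))); last first.
    by field; rewrite gt_eqF.
  by apply: le_ln1Dx; rewrite ltrN2 ltr_pdivrMr//; lra.
rewrite lerN2 in le_ln; apply: le_trans le_ln.
by apply: ler_wpM2l => //; rewrite lef_pV2 ?posrE//; lra.
Qed.

Definition tail_cst s : R := (2 + s) / s.

Lemma tail_cst_gt0 s : 0 < s -> 0 < tail_cst s.
Proof. by move=> s0; rewrite divr_gt0// addr_gt0. Qed.

(** The discrete form of the fact that n^(-s-1) is, up to the factor s, the
    opposite of the derivative of n^(-s). *)
Lemma powR_telescope s (n : nat) : 0 < s -> (0 < n)%N ->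
  (n%:R `^ s)^-1 * n%:R^-1 <=
  tail_cst s * ((n%:R `^ s)^-1 - (n.+1%:R `^ s)^-1).
Proof.
move=> s0 n0; have n0' : 0 < n%:R :> R by rewrite ltr0n.
have n1 : 1 <= n%:R :> R by rewrite ler1n.
set x : R := n%:R^-1.
have x01 : 0 <= x <= 1 by rewrite invr_ge0 ltW//= invf_le1.
have -> : n.+1%:R = n%:R * (1 + x) :> R.
  by rewrite mulrDr mulr1 mulfV ?gt_eqF// -natr1.
have x10 : 0 < 1 + x by lra.
rewrite powRM ?(ltW n0') ?(ltW x10)// invfM.
have := powR1D_ge s0 x01; set y := (1 + x) `^ s => hy.
rewrite [leRHS](_ : _ = (n%:R `^ s)^-1 * (tail_cst s * (1 - y^-1))); last by ring.
rewrite ler_pM2l ?invr_gt0 ?powR_gt0//.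
have y0 : 0 < y by rewrite powR_gt0.
rewrite -subr_ge0 /tail_cst.
have -> : (2 + s) / s * (1 - y^-1) - x = ((2 + s) * (y - 1) - s * x * y) / (s * y).
  by field; rewrite !gt_eqF.
rewrite divr_ge0 ?(mulr_ge0 (ltW s0) (ltW y0))//.
have h : 0 <= (2 + s - s * x) * (y - (1 + s * x / 2)).
  by apply: mulr_ge0; [nra|rewrite subr_ge0].
have h2 : 0 <= s ^+ 2 * (x * (1 - x)) by rewrite mulr_ge0 ?sqr_ge0// mulr_ge0; lra.
nra.
Qed.

(** With al = p/r, be = q/r and u = |x|^r, this bounds the series of truncated
    moments of x by |x|^p.  The terms are dominated by the increments of a
    bounded function Phi of n: its first part is linear in n up to u and
    accounts for the terms with n <= u, where the minimum is bounded by 1; its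
    second part is constant up to u, and its increments beyond u account for
    the tail, where the minimum is bounded by the power of u / n. *)
Lemma moment_series_le (al be u : R) (N : nat) :
  1 <= al < be -> 0 <= u ->
  \sum_(1 <= n < N.+1) n%:R `^ (al - 1) * Num.min 1 ((u / n%:R) `^ be) <=
  (1 + tail_cst (be - al)) * u `^ al.
Proof.
move=> /andP[al1 albe] u0.
have be0 : 0 < be by lra.
have [->|un0] := eqVneq u 0.
  have al0 : al != 0 by rewrite gt_eqF//; lra.
  rewrite (powR0 al0) mulr0 big1// => n _.
  by rewrite mul0r powR0 ?gt_eqF// min_r// mulr0.
have {u0 un0} u0 : 0 < u by rewrite lt_def un0.
set s := be - al; have s0 : 0 < s by rewrite subr_gt0.
set K := tail_cst s; have K0 : 0 < K by exact: tail_cst_gt0.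
pose mx n := Num.max n%:R u.
pose Phi n := Num.min n.-1%:R u * u `^ (al - 1) +
  K * (u `^ al - u `^ be * (mx n `^ s)^-1).
have uab : u `^ al = u `^ be * (u `^ s)^-1.
  rewrite -powRN powRD_gt0//; congr (_ `^ _).
  by rewrite /s; lra.
have Phi1 : 0 <= Phi 1%N.
  rewrite /Phi/= min_l ?(ltW u0)// mul0r add0r mulr_ge0 ?(ltW K0)// subr_ge0 uab.
  by rewrite ler_wpM2l ?powR_ge0// powRN_le// le_max lexx orbT.
have step n : (0 < n)%N -> n%:R `^ (al - 1) * Num.min 1 ((u / n%:R) `^ be) <=
    Phi n.+1 - Phi n.
  move=> n0; have n0' : 0 < n%:R :> R by rewrite ltr0n.
  have mM : (mx n.+1 `^ s)^-1 <= (mx n `^ s)^-1.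
    apply: powRN_le => //; first by rewrite lt_max u0 orbT.
    by rewrite ge_max !le_max lexx orbT andbT ler_nat leqnSn.
  have -> : Phi n.+1 - Phi n =
      (Num.min n%:R u - Num.min n.-1%:R u) * u `^ (al - 1) +
      K * u `^ be * ((mx n `^ s)^-1 - (mx n.+1 `^ s)^-1).
    by rewrite /Phi/=; ring.
  have [nu|un] := leP n%:R u.
    rewrite ler_wpDr//.
      by apply: mulr_ge0; rewrite ?subr_ge0// mulr_ge0 ?powR_ge0// ltW.
    have -> : Num.min n.-1%:R u = n%:R - 1.
      rewrite -subn1 natrB// min_l//; lra.
    rewrite subKr mul1r; apply: le_trans (_ : _ <= n%:R `^ (al - 1)) _.
      by rewrite -[leRHS]mulr1 ler_wpM2l ?powR_ge0// ge_min lexx.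
    by apply: ge0_ler_powR => //; rewrite ?nnegrE ?subr_ge0// ltW.
  rewrite ler_wpDl//; first by rewrite mulr_ge0 ?powR_ge0 ?subr_ge0 ?ge_min ?lexx ?orbT.
  have -> : mx n = n%:R by rewrite /mx max_l// ltW.
  have -> : mx n.+1 = n.+1%:R.
    by rewrite /mx max_l// (le_trans (ltW un))// ler_nat leqnSn.
  apply: le_trans (_ : _ <= u `^ be * ((n%:R `^ s)^-1 * n%:R^-1)) _.
    apply: le_trans (_ : _ <= n%:R `^ (al - 1) * (u / n%:R) `^ be) _.
      by rewrite ler_wpM2l ?powR_ge0// ge_min lexx orbT.
    rewrite powRM ?invr_ge0 ?(ltW u0) ?(ltW n0')// mulrCA ler_wpM2l ?powR_ge0//.
    rewrite -[n%:R^-1]powR_inv1 ?(ltW n0')// -powRrM -powRN !powRD_gt0//.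
    by rewrite [leLHS](_ : _ = n%:R `^ (- s + -1))//; congr (_ `^ _); rewrite /s; ring.
  rewrite mulrAC [leRHS]mulrC ler_wpM2l ?powR_ge0//.
  exact: powR_telescope.
have sumPhi : \sum_(1 <= n < N.+1) n%:R `^ (al - 1) * Num.min 1 ((u / n%:R) `^ be)
    <= Phi N.+1.
  elim: N => [|N IH]; first by rewrite big_geq.
  rewrite big_nat_recr//= -[leRHS](subrK (Phi N.+1)) addrC.
  by rewrite lerD// step.
apply: le_trans sumPhi _; rewrite /Phi mulrDl mul1r; apply: lerD.
  rewrite -[u `^ al]mulr_powRB1 ?(ltW u0)//; last lra.
  by rewrite ler_wpM2r ?powR_ge0// ge_min lexx orbT.
rewrite ler_wpM2l ?(ltW K0)// lerBlDr lerDl mulr_ge0 ?powR_ge0// invr_ge0 powR_ge0//.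
Qed.

End moment_series.

(** * Integrating over the product space *)

Section tonelli.
Local Open Scope ereal_scope.

(** Tonelli for an indicator function: both sides are the product measure of A,
    which is unique. *)
Lemma integral_xsection_ysection d1 d2 (T1 : measurableType d1)
    (T2 : measurableType d2) (R : realType)
    (m1 : {sigma_finite_measure set T1 -> \bar R})
    (m2 : {sigma_finite_measure set T2 -> \bar R}) (A : set (T1 * T2)) :
  measurable A ->
  \int[m1]_x m2 (xsection A x) = \int[m2]_y m1 (ysection A y).
Proof.
move=> mA; rewrite -[LHS]/((m1 \x m2) A) -[RHS]/((m1 \x^ m2) A).
by apply: product_measure_unique => //= ? ? ? ?; rewrite product_measure2E.
Qed.

Lemma ae_summable d (T : measurableType d) (R : realType)
    (mu : {measure set T -> \bar R}) (h : nat -> T -> \bar R) (B : \bar R) :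
  (forall n, measurable_fun setT (h n)) -> (forall n t, 0 <= h n t) ->
  B < +oo -> (forall N, \sum_(1 <= n < N.+1) \int[mu]_t h n t <= B) ->
  {ae mu, forall t, \sum_(1 <= n <oo) h n t < +oo}.
Proof.
move=> mh h0 Boo hB.
pose f n t := if (1 <= n)%N then h n t else 0.
have f0 n t : 0 <= f n t by rewrite /f; case: ifP.
have mf n : measurable_fun setT (f n).
  by case: n => [|n]; [exact: measurable_cst|exact: mh].
have hf t : \sum_(1 <= n <oo) h n t = \sum_(n <oo) f n t.
  by rewrite eseries_cond eseries_mkcondr.
have ms : measurable_fun setT (fun t => \sum_(n <oo) f n t).
  by apply: ge0_emeasurable_sum => // k _; exact: mf.
have intf : mu.-integrable setT (fun t => \sum_(n <oo) f n t).
  apply/integrableP; split => //.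
  under eq_integral do rewrite gee0_abs ?nneseries_ge0//.
  rewrite integral_nneseries//; apply: le_lt_trans Boo.
  apply: lime_le; first by apply: is_cvg_nneseries => n _ _; exact: integral_ge0.
  apply: nearW => -[|N].
    rewrite big_geq//; apply: le_trans (hB 0%N).
    by rewrite big_geq.
  rewrite big_ltn// {1}/f/= integral0 add0e.
  apply: le_trans (hB N); rewrite le_eqVlt; apply/orP; left; apply/eqP.
  by apply: eq_big_nat => n /andP[n1 _]; rewrite /f n1.
have := integrable_ae measurableT intf.
apply: filterS => t /(_ I); rewrite hf => /fin_numPlt.
by case/andP.
Qed.

End tonelli.

(** * The exceedance events *)

Section fourier.
Context (R : realType) (d : measure_display) (T : measurableType d)
  (P : probability T R) (X : nat -> {RV P >-> R}).
Local Notation mu := (@lebesgue_measure R).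
Local Notation D := (`[- pi, pi]%classic : set R).

(** The condition on t confines the set to a set of finite measure; its section
    at a t in the period is the event that the maximum is large. *)
Definition exceedance (eps r : R) (n : nat) : set (R * T) :=
  [set z | D z.1 /\ eps * n%:R `^ r^-1 < max_fourier_sum X n z.1 z.2].

Lemma measurable_exceedance eps r n : measurable (exceedance eps r n).
Proof.
have mM : measurable_fun setT
    (fun z : R * T => block_max (fun k => X k z.2) 1 n.+1 z.1).
  apply: (@measurable_block_max R _ _ fst (fun k z => X k z.2)) => //.
  by move=> k; apply: measurableT_comp => //.
rewrite (_ : exceedance _ _ _ = (D `*` setT) `&` (setT `&`
   (fun z : R * T => block_max (fun k => X k z.2) 1 n.+1 z.1) @^-1`
     `]eps * n%:R `^ r^-1, +oo[)).
  apply: measurableI; first by apply: measurableX.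
  exact: mM.
rewrite setTI; apply/seteqP; split => -[t w] [].
  by move=> Dt /= lt; split => //=; rewrite in_itv/= andbT.
by move=> [Dt _] lt; split => //; move: lt; rewrite /= in_itv/= andbT.
Qed.

Definition truncated_power (q lam x : R) : R := Num.min 1 ((`|x| / lam) `^ q).

Lemma truncated_power_ge0 q lam x : 0 <= truncated_power q lam x.
Proof. by rewrite /truncated_power le_min ler01 powR_ge0. Qed.

Lemma measurable_truncated_power q lam : measurable_fun setT (truncated_power q lam).
Proof.
apply: measurable_minr => //.
apply: (measurableT_comp (measurable_powR q)).
by apply: measurable_funM => //; exact: measurable_normr.
Qed.

Lemma identically_distributed_integral (g : R -> R) (k : nat) :
  identically_distributed X -> (1 <= k)%N -> measurable_fun setT g ->
  (forall x, 0 <= g x) ->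
  (\int[P]_w (g (X k w))%:E = \int[P]_w (g (X 1%N w))%:E)%E.
Proof.
move=> idX k1 mg g0.
have mEg : measurable_fun setT (EFin \o g) by exact/measurable_EFinP.
have Eg0 x : (0 <= (EFin \o g) x)%E by rewrite lee_fin.
rewrite -(ge0_integral_distribution (X k) mEg Eg0).
rewrite -(ge0_integral_distribution (X 1%N) mEg Eg0).
by apply: eq_measure_integral => A mA _; exact: idX.
Qed.

End fourier.

Section exceedance_bound.
Context (R : realType) (d : measure_display) (T : measurableType d)
  (P : probability T R) (X : nat -> {RV P >-> R}).
Local Notation mu := (@lebesgue_measure R).

Lemma level_cst_ge0 (q eps : R) : 0 < q < 2 -> 0 < eps -> 0 <= level_cst q eps.
Proof.
move=> /andP[q0 q2] e0; have pi0 := pi_gt0 R.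
rewrite /level_cst; apply: addr_ge0; first by rewrite mulr_ge0// ltW.
apply: divr_ge0; last exact: sqr_ge0.
by rewrite maximal_cst_ge0// ltr_pdivlMr// mul1r.
Qed.

(** The inner integration is over t for fixed omega, where the coefficients are
    plain numbers; expectations are taken afterwards, term by term, so that
    only the common law of the variables matters. *)
Lemma exceedance_le (q eps r : R) (n : nat) :
  identically_distributed X -> 0 < q < 2 -> 0 < eps -> (0 < n)%N ->
  (\int[mu]_t P (xsection (exceedance X eps r n) t) <=
   (level_cst q eps * n%:R)%:E *
   \int[P]_w (truncated_power q (n%:R `^ r^-1) (X 1%N w))%:E)%E.
Proof.
move=> idX q02 e0 n0; have C0 := level_cst_ge0 q02 e0.
have mE := measurable_exceedance X eps r n.
rewrite integral_xsection_ysection//.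
set lam : R := n%:R `^ r^-1.
have l0 : 0 < lam by rewrite powR_gt0// ltr0n.
have mtp k : measurable_fun setT (fun w => (truncated_power q lam (X k w))%:E).
  apply/measurable_EFinP.
  by apply: measurableT_comp => //; exact: measurable_truncated_power.
have tp0 k w : (0 <= (truncated_power q lam (X k w))%:E)%E.
  by rewrite lee_fin truncated_power_ge0.
apply: (@le_trans _ _ (\int[P]_w ((level_cst q eps)%:E *
    \sum_(1 <= k < n.+1) (truncated_power q lam (X k w))%:E))%E).
  apply: ge0_le_integral => //.
  - exact: measurable_fun_ysection.
  - by apply: measurable_funeM; exact: emeasurable_sum.
  - move=> w _; rewrite sumEFin -EFinM.
    apply: le_trans (level_set_le (fun k => X k w) 1 n.+1 q02 e0 l0).
    rewrite le_eqVlt; apply/orP; left; apply/eqP; congr (mu _).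
    by apply/seteqP; split => t /=; rewrite /ysection/= inE.
rewrite ge0_integralZl//; first last.
- by move=> w _; exact: sume_ge0.
- exact: emeasurable_sum.
rewrite ge0_integral_sum//.
rewrite EFinM -muleA; apply: lee_wpmul2l; first by rewrite lee_fin.
rewrite (eq_big_nat _ _ (F2 := fun=> (\int[P]_w (truncated_power q lam (X 1%N w))%:E)%E)).
  by rewrite sumr_const_nat subSS subn0 mule_natl.
move=> k /andP[k1 _]; apply: identically_distributed_integral => //.
  exact: measurable_truncated_power.
exact: truncated_power_ge0.
Qed.

(** The form in which the truncated moments are summed: the threshold n^(1/r) on
    y becomes the threshold n on |y|^r. *)
Lemma truncated_powerE (q r y : R) (n : nat) : 0 < r -> (0 < n)%N ->
  truncated_power q (n%:R `^ r^-1) y =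
  Num.min 1 ((`|y| `^ r / n%:R) `^ (q / r)).
Proof.
move=> r0 n0; rewrite /truncated_power; congr Num.min.
move: (n%:R : R) (ler0n R n) => x x0.
have y0 : 0 <= `|y| by [].
rewrite (_ : (x `^ r^-1)^-1 = x `^ (- r^-1)); last by rewrite powRN.
rewrite (_ : x^-1 = x `^ (-1)); last by rewrite powR_inv1.
rewrite (powRM _ y0 (powR_ge0 _ _)) (powRM _ (powR_ge0 _ _) (powR_ge0 _ _)).
rewrite -3!powRrM; by congr (_ `^ _ * _ `^ _); field; rewrite gt_eqF.
Qed.

Lemma sum_exceedance_le (p q r eps : R) (N : nat) :
  identically_distributed X -> 1 < p -> p < q < 2 -> 1 <= r <= p -> 0 < eps ->
  (\sum_(1 <= n < N.+1) (n%:R `^ (p / r - 2))%:E *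
     \int[mu]_t P (xsection (exceedance X eps r n) t) <=
   (level_cst q eps * (1 + tail_cst (q / r - p / r)))%:E *
     \int[P]_w (`|X 1%N w| `^ p)%:E)%E.
Proof.
move=> idX p1 /andP[pq q2] /andP[r1 rp] e0.
have r0 : 0 < r by lra.
have s0 : 0 < q / r - p / r by rewrite subr_gt0 ltr_pM2r ?invr_gt0.
have q02 : 0 < q < 2 by apply/andP; split => //; lra.
have C0 := level_cst_ge0 q02 e0.
have mtp n : measurable_fun setT (fun w =>
    (n%:R `^ (p / r - 1) * truncated_power q (n%:R `^ r^-1) (X 1%N w))%:E).
  apply/measurable_EFinP; apply: measurable_funM => //.
  by apply: measurableT_comp => //; exact: measurable_truncated_power.
apply: (@le_trans _ _ (\sum_(1 <= n < N.+1) ((level_cst q eps)%:E * \int[P]_w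
    (n%:R `^ (p / r - 1) * truncated_power q (n%:R `^ r^-1) (X 1%N w))%:E))%E).
  rewrite !big_nat; apply: lee_sum => n /andP[n0 _].
  have -> : (\int[P]_w
      (n%:R `^ (p / r - 1) * truncated_power q (n%:R `^ r^-1) (X 1%N w))%:E =
      (n%:R `^ (p / r - 1))%:E *
      \int[P]_w (truncated_power q (n%:R `^ r^-1) (X 1%N w))%:E)%E.
    under eq_integral do rewrite EFinM.
    rewrite ge0_integralZl//.
    - apply/measurable_EFinP.
      by apply: measurableT_comp => //; exact: measurable_truncated_power.
    - by move=> w _; rewrite lee_fin truncated_power_ge0.
  have w0 : (0 <= (n%:R `^ (p / r - 2))%:E :> \bar R)%E by rewrite lee_fin powR_ge0.
  apply: le_trans (lee_wpmul2l w0 (exceedance_le r idX q02 e0 n0)) _.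
  rewrite !muleA -!EFinM; apply: lee_wpmul2r.
    by apply: integral_ge0 => w _; rewrite lee_fin truncated_power_ge0.
  rewrite lee_fin mulrCA ler_wpM2l// -[n%:R in X in _ * X]powRr1//.
  rewrite powRD_gt0 ?ltr0n//.
  by rewrite le_eqVlt; apply/orP; left; apply/eqP; congr (_ `^ _); lra.
rewrite -ge0_sume_distrr; last first.
  move=> n _; apply: integral_ge0 => w _.
  by rewrite lee_fin mulr_ge0 ?powR_ge0 ?truncated_power_ge0.
rewrite EFinM -muleA; apply: lee_wpmul2l; first by rewrite lee_fin.
rewrite -ge0_integral_sum//; last first.
  by move=> n w _; rewrite lee_fin mulr_ge0 ?powR_ge0 ?truncated_power_ge0.
have mp : measurable_fun setT (fun w => (`|X 1%N w| `^ p)%:E).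
  apply/measurable_EFinP; apply: (measurableT_comp (measurable_powR p)).
  exact: measurableT_comp.
rewrite -ge0_integralZl//; first last.
- by rewrite lee_fin addr_ge0// ltW// tail_cst_gt0.
apply: ge0_le_integral => //.
- move=> w _; apply: sume_ge0 => n _.
  by rewrite lee_fin mulr_ge0 ?powR_ge0 ?truncated_power_ge0.
- exact: emeasurable_sum.
- exact: measurable_funeM.
move=> w _; rewrite sumEFin -EFinM lee_fin.
have pr : 1 <= p / r < q / r by rewrite ler_pdivlMr// mul1r rp/= -subr_gt0.
have := moment_series_le N pr (powR_ge0 `|X 1%N w| r).
rewrite -powRrM mulrCA mulfV ?gt_eqF// mulr1; apply: le_trans.
rewrite le_eqVlt; apply/orP; left; apply/eqP; apply: eq_big_nat => n /andP[n0 _].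
by rewrite truncated_powerE.
Qed.

End exceedance_bound.

Theorem theorem1p3 (R : realType) (d : measure_display) (T : measurableType d)
    (P : probability T R) (X : nat -> {RV P >-> R}) (p r : R)
    (hp : 1 < p < 2) (hr : 1 <= r <= p)
    (hX : identically_distributed X)
    (hmom : ('E_P[fun w => (`|X 1%N w| `^ p)%R] < +oo)%E)
    (eps : R) (heps : 0 < eps) :
  {ae lebesgue_measure, forall t : R, t \in `[- pi, pi[ ->
    (\sum_(1 <= n <oo)
        ((n%:R `^ (p / r - 2))%:E *
         P [set w | (eps * n%:R `^ r^-1 < max_fourier_sum X n t w)%R]) < +oo)%E}.
Proof.
have /andP[p1 p2] := hp.
(* Any exponent strictly between p and 2 would do. *)
pose q : R := (p + 2) / 2.
have pq2 : p < q < 2 by rewrite /q; apply/andP; split; lra.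
pose h n t : \bar R :=
  ((n%:R `^ (p / r - 2))%:E * P (xsection (exceedance X eps r n) t))%E.
have mP n : measurable_fun setT (fun t => P (xsection (exceedance X eps r n) t)).
  by apply: measurable_fun_xsection; exact: measurable_exceedance.
have w0 n : (0 <= (n%:R `^ (p / r - 2))%:E :> \bar R)%E by rewrite lee_fin powR_ge0.
have sum_h N : (\sum_(1 <= n < N.+1) \int[lebesgue_measure]_t h n t <=
    (level_cst q eps * (1 + tail_cst (q / r - p / r)))%:E *
    \int[P]_w (`|X 1%N w| `^ p)%:E)%E.
  apply: le_trans (sum_exceedance_le N hX p1 pq2 hr heps).
  apply: lee_sum => n _.
  have <- := ge0_integralZl lebesgue_measure measurableT (mP n)
    (fun t _ => measure_ge0 P _) (w0 n).
  exact: lexx.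
have moment_lty : (\int[P]_w (`|X 1%N w| `^ p)%:E < +oo)%E.
  by move: hmom; rewrite unlock.
have moment_ge0 : (0 <= \int[P]_w (`|X 1%N w| `^ p)%:E)%E.
  by apply: integral_ge0 => w _; rewrite lee_fin powR_ge0.
have bound_lty : ((level_cst q eps * (1 + tail_cst (q / r - p / r)))%:E *
    \int[P]_w (`|X 1%N w| `^ p)%:E < +oo)%E.
  apply: lte_mul_pinfty => //; rewrite lee_fin mulr_ge0 ?level_cst_ge0//.
    by apply/andP; split; lra.
  rewrite addr_ge0// ltW// tail_cst_gt0// subr_gt0 ltr_pM2r ?invr_gt0; lra.
have mh n : measurable_fun setT (h n) by exact: measurable_funeM.
have h0 n t : (0 <= h n t)%E by exact: mule_ge0.
have := @ae_summable _ _ R lebesgue_measure h _ mh h0 bound_lty sum_h.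
apply: filterS => t sum_lty; rewrite in_itv/= => /andP[tl tr].
rewrite (eq_eseriesr (g := h ^~ t))// => n _.
rewrite /h; congr (_ * P _)%E; apply/seteqP; split => w.
  move=> lt; rewrite /xsection/= inE; split => //=.
  by rewrite in_itv/= tl ltW.
by rewrite /xsection/= inE => -[].
Qed.
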